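(* Let $\Bbbk$ be a field. If $R$ and $R'$ are the respective semigroup rings over $\Bbbk$ of numerical semigroups $S$ and $S'$ of multiplicity $m$ that lie in the same face of the Kunz cone $C_m$, then they have the same Poincaré series, that is, $P^R_{\Bbbk}(z) = P^{R'}_{\Bbbk}(z)$. In particular, the rationality of the Poincaré series of $R$ is determined by the face of $C_m$ containing $S$.
   Context: A numerical semigroup is a cofinite additively closed set $S \subseteq \mathbb Z_{\ge 0}$ containing $0$; its multiplicity is $m = \min(S\setminus\{0\})$. Its Apéry set is $\operatorname{Ap}(S) = \{n \in S : n - m \notin S\} = \{0, a_1, \ldots, a_{m-1}\}$ with $a_i \equiv i \bmod m$. The semigroup ring of $S$ is $R = \Bbbk[S] = \Bbbk[t^s : s\in S] \subseteq \Bbbk[t]$, graded by $S$, and $\Bbbk$ is the quotient of $R$ by its maximal monomial ideal. The Kunz cone $C_m \subseteq \mathbb R_{\ge 0}^{m-1}$ ($m\ge 2$) is the polyhedral cone defined by the inequalities $z_i + z_j \ge z_{i+j}$ for all $i,j \in \{1,\ldots,m-1\}$ with $i+j \not\equiv 0 \bmod m$ (subscripts modulo $m$). A numerical semigroup $S$ of multiplicity $m$ lies in a face $F$ of $C_m$ if $(a_1,\ldots,a_{m-1})$ lies in the relative interior of $F$; thus $S$ and $S'$ lie in the same face when their corresponding points lie in the relative interior of the same face. The Poincaré series of $R$ is the formal power series $P^R_{\Bbbk}(z) = \sum_{i\ge 0} \beta_i^R(\Bbbk) z^i$, where $\beta_i^R(\Bbbk) = \dim_{\Bbbk} \operatorname{Tor}_i^R(\Bbbk,\Bbbk)$.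 It is rational if it is the power series expansion of a rational function. *)

(* Defs.v *)
From HB Require Import structures.
From mathcomp Require Import all_boot all_order all_algebra.
From mathcomp Require Import all_classical all_reals all_analysis.

Set Implicit Arguments.
Unset Strict Implicit.
Unset Printing Implicit Defensive.

Import Order.TTheory GRing.Theory Num.Theory.
Import numFieldNormedType.Exports.

Local Open Scope classical_set_scope.
Local Open Scope ring_scope.

(* Membership is boolean: this loses nothing, a cofinite set being decidable. *)
Record numerical_semigroup := NumericalSemigroup {
  ns_mem :> pred nat;
  ns_mem0 : ns_mem 0%N;
  ns_memD : forall a b, ns_mem a -> ns_mem b -> ns_mem (a + b)%N;
  ns_cofinite : exists N, forall n, (N <= n)%N -> ns_mem n }.

Lemma ns_pos_ex (S : numerical_semigroup) : exists n, (0 < n)%N && S n.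
Proof. by have [N SN] := ns_cofinite S; exists N.+1; rewrite SN. Qed.

Definition multiplicity (S : numerical_semigroup) : nat := ex_minn (ns_pos_ex S).

Lemma multiplicity_gt0 S : (0 < multiplicity S)%N.
Proof. by rewrite /multiplicity; case: ex_minnP => n /andP[]. Qed.

(* [n - m] is an integer difference: it is negative, hence not in [S], when
   [n < m]. *)
Definition apery (S : numerical_semigroup) : pred nat := fun n =>
  S n && ((n < multiplicity S)%N || ~~ S (n - multiplicity S)%N).

Lemma apery_ex (S : numerical_semigroup) (i : nat) :
  exists n, apery S n && (n == i %[mod multiplicity S]).
Proof.
set m := multiplicity S; have m0 : (0 < m)%N := multiplicity_gt0 S.
have ex : exists n, S n && (n == i %[mod m]).
  have [N SN] := ns_cofinite S; exists (N * m + i)%N.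
  by rewrite SN ?modnMDl ?eqxx // (leq_trans _ (leq_addr _ _)) ?leq_pmulr.
case: (ex_minnP ex) => n /andP[Sn /eqP ni] nmin.
exists n; rewrite /apery -/m Sn ni eqxx andbT /=.
case: ltnP => //= mn; apply/negP => Snm.
have := nmin (n - m)%N; rewrite Snm -ni -{2}(subnK mn) modnDr eqxx => /(_ isT).
by rewrite leqNgt ltn_subrL m0 (leq_trans m0 mn).
Qed.

Definition apery_elt (S : numerical_semigroup) (i : nat) : nat :=
  xchoose (apery_ex S i).

Section SemigroupRing.
Variables (k : fieldType) (S : numerical_semigroup).

Definition semigroup_poly : {pred {poly k}} :=
  fun p => all (fun i => (p`_i != 0) ==> S i) (iota 0 (size p)).

Lemma semigroup_polyP (p : {poly k}) :
  reflect (forall i, p`_i != 0 -> S i) (p \in semigroup_poly).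
Proof.
apply: (iffP allP) => [H i pi | H i _]; last exact/implyP/H.
apply: (implyP (H i _)) => //; rewrite mem_iota /= add0n ltnNge.
by apply: contra pi => /(nth_default 0)->.
Qed.

Fact semigroup_poly_closed : subring_closed semigroup_poly.
Proof.
split=> [|p q /semigroup_polyP pS /semigroup_polyP qS
         |p q /semigroup_polyP pS /semigroup_polyP qS];
  apply/semigroup_polyP => i.
- by rewrite coef1; case: i => [|i]; rewrite ?eqxx // => _; exact: ns_mem0.
- rewrite coefB; have [->|/pS//] := eqVneq p`_i 0.
  by rewrite sub0r oppr_eq0 => /qS.
rewrite coefM => nz; apply: contraNT nz => /negP nSi; apply/eqP/big1 => j _.
have [->|/pS Sj] := eqVneq p`_j 0; first by rewrite mul0r.
have [->|/qS Sij] := eqVneq q`_(i - j) 0; first by rewrite mulr0.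
by case: nSi; rewrite -(subnKC (ltn_ord j : j <= i)%N); exact: ns_memD.
Qed.

HB.instance Definition _ :=
  GRing.isSubringClosed.Build {poly k} semigroup_poly semigroup_poly_closed.

(* k[S], the k-span of the t^s for s in S. *)
Record semigroup_ring :=
  SemigroupRing { sring_val :> {poly k}; _ : sring_val \in semigroup_poly }.

HB.instance Definition _ := [isSub for sring_val].
HB.instance Definition _ := [Choice of semigroup_ring by <:].
HB.instance Definition _ := [SubChoice_isSubComNzRing of semigroup_ring by <:].

(* The quotient map k[S] -> k by the maximal monomial ideal, whose elements are
   the polynomials without constant term. *)
Definition residue : {rmorphism semigroup_ring -> k} :=
  GRing.RMorphism.clone _ _ (coefp 0 \o val : semigroup_ring -> k) _.

End SemigroupRing.

Section Tor.
Variables (A : comNzRingType) (k : fieldType) (eps : {rmorphism A -> k}).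

(* A resolution  ... -> A^(r 2) -> A^(r 1) -> A^(r 0) -> k -> 0  of k, viewed
   as an A-module through eps, by free A-modules of finite rank.  Maps between
   free modules act on row vectors by right multiplication; the A-linear maps
   A^n -> k are the x |-> eps(x) u, with u a column vector over k. *)
Record free_resolution := FreeResolution {
  fr_rank : nat -> nat;
  fr_diff : forall i, 'M[A]_(fr_rank i.+1, fr_rank i);
  fr_aug : 'cV[k]_(fr_rank 0);
  fr_aug_surj : forall c : 'cV[k]_1, exists x : 'rV[A]_(fr_rank 0),
    map_mx eps x *m fr_aug = c;
  fr_exact0 : forall x : 'rV[A]_(fr_rank 0),
    map_mx eps x *m fr_aug = 0 <-> exists y, x = y *m fr_diff 0;
  fr_exactS : forall i (x : 'rV[A]_(fr_rank i.+1)),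
    x *m fr_diff i = 0 <-> exists y, x = y *m fr_diff i.+1 }.

(* The differential k^(r i.+1) -> k^(r i) of the complex F (x)_A k. *)
Definition fr_diff_res (F : free_resolution) i :
    'M[k]_(fr_rank F i.+1, fr_rank F i) :=
  map_mx eps (fr_diff F i).

Definition fr_cycles (F : free_resolution) i : 'M[k]_(fr_rank F i) :=
  if i is j.+1 then kermx (fr_diff_res F j) else 1%:M.

(* dim_k H_i(F (x)_A k); the boundaries are contained in the cycles. *)
Definition tor_dim (F : free_resolution) i : nat :=
  (\rank (fr_cycles F i) - \rank (fr_diff_res F i))%N.

(* beta_i = dim_k Tor_i^A(k, k), computed from any resolution F as above.  When
   A is Noetherian and eps is onto (as for semigroup rings) such an F exists, and
   tor_dim F i does not depend on it, so that the default value 0 is not used. *)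
Definition betti i : nat :=
  xget 0%N [set b | exists F : free_resolution, tor_dim F i = b].

End Tor.

(* Power series are represented by their sequences of coefficients. *)
Definition poincare_series (k : fieldType) (S : numerical_semigroup) :
  nat -> nat := betti (@residue k S).

(* f is the expansion at 0 of p / q, that is, q f = p with q(0) <> 0. *)
Definition rational_series (f : nat -> nat) : Prop :=
  exists p q : {poly rat}, q`_0 != 0 /\
    forall n, \sum_(i < n.+1) q`_i * (f (n - i)%N)%:R = p`_n.

Section Cones.
Variables (R : realType) (n : nat).
Implicit Types A C F : set 'rV[R]_n.

Definition affine_set A : Prop :=
  forall (x y : 'rV[R]_n) (t : R), A x -> A y -> A ((1 - t) *: x + t *: y).

Definition affine_hull A : set 'rV[R]_n := smallest affine_set A.

Definition relative_interior A : set 'rV[R]_n :=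
  [set x | A x /\ \forall y \near x, affine_hull A y -> A y].

(* Nonempty faces of a cone: the supporting hyperplane passes through 0; l = 0
   gives the face C itself. *)
Definition is_face C F : Prop :=
  exists l : 'cV[R]_n, (forall x, C x -> 0 <= (x *m l) 0 0) /\
    F = [set x | C x /\ (x *m l) 0 0 = 0].

End Cones.

(* The coordinate of index j : 'I_m.-1 is z_(j.+1). The nonnegativity conditions
   follow from the other ones when m >= 3, but not when m = 2. *)
Definition kunz_cone (R : realType) (m : nat) : set 'rV[R]_m.-1 :=
  [set z | (forall i, 0 <= z 0 i) /\
     forall i j l : 'I_m.-1, (i.+1 + j.+1 = l.+1 %[mod m])%N ->
       z 0 l <= z 0 i + z 0 j].

Arguments kunz_cone R m : clear implicits.

Definition kunz_point (R : realType) (m : nat) (S : numerical_semigroup) :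
  'rV[R]_m.-1 := \row_(j < m.-1) (apery_elt S j.+1)%:R.

(* To be used for S of multiplicity m and F a face of the Kunz cone C_m. *)
Definition lies_in_face (R : realType) (m : nat) (S : numerical_semigroup)
    (F : set 'rV[R]_m.-1) : Prop :=
  relative_interior F (kunz_point R m S).

(* Main.v *)
Require Import Defs.
From HB Require Import structures.
From mathcomp Require Import all_boot all_order all_algebra.
From mathcomp Require Import all_classical all_reals all_analysis.
From mathcomp Require Import zify lra.

Set Implicit Arguments.
Unset Strict Implicit.
Unset Printing Implicit Defensive.

Import Order.TTheory GRing.Theory Num.Theory.
Import numFieldNormedType.Exports.

Local Open Scope classical_set_scope.
Local Open Scope ring_scope.

(** Write m for the common multiplicity and x = t^m in k[S].  The element x is
a nonzerodivisor of k[S], and the monomials t^(a_i) at the Apery elements form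
a basis of k[S]/(x), in which t^(a_i) t^(a_j) is t^(a_l) when a_i + a_j = a_l
for some l, and 0 when there is no such l, because a_i + a_j - m is then in S.
So the algebra k[S]/(x) only depends on the set of triples (i, j, l) such that
a_i + a_j = a_l.  Apart from the trivial triples with i = 0 or j = 0, these say
which inequalities of the Kunz cone are equalities at the point of S, and this
is the same for all the points in the relative interior of a face
([face_same_apery_sums]).  Hence k[S]/(x) and k[S']/(x) are the same augmented
algebra, [apery_algebra k S].

It remains to recover the Betti numbers of k over k[S] from those of k over
k[S]/(x).  As S has no element strictly between 0 and m, the coefficient of t^m
is a point derivation of k[S] at the maximal monomial ideal, so x is not in the
square of that ideal.  Then the classical formula
  P^A(z) = (1 + z) P^(A/(x))(z)
applies ([betti_regular_quotient]).  It is proved by lifting a free resolution G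
of k over A/(x) to one over A.  Lifting the differentials arbitrarily gives
matrices D over A with D D = x H, and (u, v) |-> (u D + x v, - u H - v D) is the
differential of a free resolution of k over A, of rank g_i + g_(i-1) in degree
i.  When the derivation vanishes on the entries of D, the matrix H is 0 after
reduction to k, and so this resolution has the required Betti numbers.

Two general facts make Betti numbers computable in this way: any two free
resolutions yield the same dimensions ([betti_tor_dim]), and a resolution of
finite rank exists over a finite-dimensional algebra such as k[S]/(x)
([free_resolution_exists] and [finite_algebra_noetherian]). *)

(** * Independence of the resolution *)

Section Subquotient.
Variable k : fieldType.

Lemma mxrank_mul_coker m n p (Z : 'M[k]_(m, n)) (B : 'M[k]_(p, n)) :
  (B <= Z)%MS -> \rank (Z *m cokermx B) = (\rank Z - \rank B)%N.
Proof.
move=> BZ; have := mxrank_mul_ker Z (cokermx B).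
have kB : (kermx (cokermx B) :=: B)%MS.
  apply/eqmxP/andP; split; last by apply/sub_kermxP; rewrite mulmx_coker.
  by rewrite submxE mulmx_ker.
suff -> : \rank (Z :&: kermx (cokermx B))%MS = \rank B by lia.
by rewrite (cap_eqmx (eqmx_refl Z) kB); apply/eqmx_rank/eqmxP/capmx_idPr.
Qed.

(** The map induced by f from Z1 / B1 to Z2 / B2 is injective: if z f is in B2,
then z f g is in B1, and so is z. *)
Lemma subquotient_rank_le n1 n2 p1 p2 q1 q2
    (Z1 : 'M[k]_(p1, n1)) (B1 : 'M[k]_(q1, n1))
    (Z2 : 'M[k]_(p2, n2)) (B2 : 'M[k]_(q2, n2))
    (f : 'M[k]_(n1, n2)) (g : 'M[k]_(n2, n1)) :
    (B1 <= Z1)%MS -> (B2 <= Z2)%MS -> (Z1 *m f <= Z2)%MS ->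
    (B2 *m g <= B1)%MS -> (Z1 *m (f *m g - 1%:M) <= B1)%MS ->
  (\rank Z1 - \rank B1 <= \rank Z2 - \rank B2)%N.
Proof.
move=> B1Z1 B2Z2 fZ gB fg; rewrite -!mxrank_mul_coker//.
apply: (@leq_trans (\rank (Z1 *m f *m cokermx B2))); last first.
  by apply/mxrankS/submxMr.
(* Both ranks are compared through the kernels of the maps
w |-> w *m Z1 modulo B1 and w |-> w *m Z1 *m f modulo B2. *)
have kle : (kermx (Z1 *m f *m cokermx B2) <= kermx (Z1 *m cokermx B1))%MS.
  set w := kermx _; apply/sub_kermxP.
  have wf : (w *m Z1 *m f <= B2)%MS by rewrite submxE -!mulmxA mulmxA mulmx_ker.
  have wfg : (w *m Z1 *m f *m g <= B1)%MS.
    exact: submx_trans (submxMr _ wf) gB.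
  apply/eqP; rewrite mulmxA -submxE.
  have -> : w *m Z1 = w *m Z1 *m f *m g - w *m (Z1 *m (f *m g - 1%:M)).
    by rewrite !mulmxBr mulmx1 !mulmxA subKr.
  apply: addmx_sub => //; rewrite eqmx_opp.
  exact: submx_trans (submxMl _ _) fg.
have := mxrankS kle; rewrite !mxrank_ker.
by have := rank_leq_row (Z1 *m cokermx B1); lia.
Qed.

End Subquotient.

Section Comparison.
Variables (A : comNzRingType) (k : fieldType) (eps : {rmorphism A -> k}).
Implicit Types F G : free_resolution eps.

Lemma exactS_mx F i p (X : 'M[A]_(p, fr_rank F i.+1)) :
  X *m fr_diff F i = 0 -> exists Y, X = Y *m fr_diff F i.+1.
Proof.
move=> X0; have H j : exists y, row j X = y *m fr_diff F i.+1.
  by apply/fr_exactS; rewrite -row_mul X0 row0.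
have [y yP] := choice H.
by exists (\matrix_j y j); apply/row_matrixP => j; rewrite row_mul rowK.
Qed.

Lemma exact0_mx F p (X : 'M[A]_(p, fr_rank F 0)) :
  map_mx eps X *m fr_aug F = 0 -> exists Y, X = Y *m fr_diff F 0.
Proof.
move=> X0; have H j : exists y, row j X = y *m fr_diff F 0.
  by apply/fr_exact0; rewrite map_row -row_mul X0 row0.
have [y yP] := choice H.
by exists (\matrix_j y j); apply/row_matrixP => j; rewrite row_mul rowK.
Qed.

Lemma aug_surj_mx F p (C : 'cV[k]_p) :
  exists X : 'M[A]_(p, fr_rank F 0), map_mx eps X *m fr_aug F = C.
Proof.
have H j : exists x : 'rV[A]_(fr_rank F 0), map_mx eps x *m fr_aug F = row j C.
  exact: fr_aug_surj.
have [x xP] := choice H.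
exists (\matrix_j x j); apply/row_matrixP => j.
by rewrite row_mul -map_row rowK.
Qed.

Lemma diff_comp F i : fr_diff F i.+1 *m fr_diff F i = 0.
Proof.
apply/row_matrixP => j; rewrite row_mul row0; apply/fr_exactS.
by exists (delta_mx 0 j); rewrite rowE.
Qed.

Lemma aug_diff F : map_mx eps (fr_diff F 0) *m fr_aug F = 0.
Proof.
apply/row_matrixP => j; rewrite row_mul row0 -map_row; apply/fr_exact0.
by exists (delta_mx 0 j); rewrite rowE.
Qed.

Definition chain_map F G (f : forall i, 'M[A]_(fr_rank F i, fr_rank G i)) :=
  map_mx eps (f 0%N) *m fr_aug G = fr_aug F /\
  forall i, fr_diff F i *m f i = f i.+1 *m fr_diff G i.

(** The usual lifting of the identity of k along the two resolutions.  The next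
component only depends on the current one, provided that the latter is
liftable; this property is carried along by the recursion. *)
Lemma chain_map_exists F G : exists f, @chain_map F G f.
Proof.
pose liftable i (f : 'M[A]_(fr_rank F i, fr_rank G i)) :=
  exists Y, fr_diff F i *m f = Y *m fr_diff G i.
have [f0 f0P] := aug_surj_mx G (fr_aug F).
have lift0 : liftable 0%N f0.
  by apply: exact0_mx; rewrite map_mxM -mulmxA f0P aug_diff.
have step i (f : {f | liftable i f}) : exists g : {g | liftable i.+1 g},
    fr_diff F i *m sval f = sval g *m fr_diff G i.
  case: f => f /= [Y YP].
  suff lY : liftable i.+1 Y by exists (exist _ Y lY).
  by apply: exactS_mx; rewrite -mulmxA -YP mulmxA diff_comp mul0mx.
pose next i f := sval (cid (step i f)).
pose fs := fix fs i : {f | liftable i f} :=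
  if i is j.+1 then next j (fs j) else exist _ f0 lift0.
exists (fun i => sval (fs i)); split=> // i.
exact: (svalP (cid (step i (fs i)))).
Qed.

Lemma chain_map_comp F G f g :
  @chain_map F G f -> @chain_map G F g ->
  @chain_map F F (fun i => f i *m g i).
Proof.
move=> [f0 fS] [g0 gS]; split=> [|i]; first by rewrite map_mxM -mulmxA g0.
by rewrite mulmxA fS -mulmxA gS mulmxA.
Qed.

Lemma chain_endo_homotopy0 F f : @chain_map F F f ->
  exists t, f 0%N - 1%:M = t *m fr_diff F 0.
Proof.
move=> [f0 _]; apply: exact0_mx.
by rewrite map_mxB mulmxBl f0 map_mx1 mul1mx subrr.
Qed.

(** A chain endomorphism over the identity of k is homotopic to the identity.
Only one level of the homotopy is ever used, so its components are found by
induction, the next one existing as soon as f - 1 - s d is killed by d. *)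
Lemma chain_endo_homotopyS F f i : @chain_map F F f ->
  exists s t, f i.+1 - 1%:M = fr_diff F i *m s + t *m fr_diff F i.+1.
Proof.
move=> fP; have [f0 fS] := fP.
have fS1 j : (f j.+1 - 1%:M) *m fr_diff F j = fr_diff F j *m (f j - 1%:M).
  by rewrite mulmxBl mulmxBr fS mulmx1 mul1mx.
have step j s : fr_diff F j *m (f j - 1%:M - s *m fr_diff F j) = 0 ->
    exists t, f j.+1 - 1%:M = fr_diff F j *m s + t *m fr_diff F j.+1.
  move=> H; have : (f j.+1 - 1%:M - fr_diff F j *m s) *m fr_diff F j = 0.
    by rewrite mulmxBl fS1 -mulmxA -mulmxBr.
  by move=> /exactS_mx[t tP]; exists t; rewrite -tP [RHS]addrC subrK.
suff [s sP] : exists s, fr_diff F i *m (f i - 1%:M - s *m fr_diff F i) = 0.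
  by exists s; exact: step.
elim: i => [|i [s /step[t tP]]].
  by have [t ->] := chain_endo_homotopy0 fP; exists t; rewrite subrr mulmx0.
by exists t; rewrite tP addrK mulmxA diff_comp mul0mx.
Qed.

Lemma diff_res_comp F i : fr_diff_res F i.+1 *m fr_diff_res F i = 0.
Proof. by rewrite -map_mxM diff_comp map_mx0. Qed.

Lemma boundaries_sub_cycles F i : (fr_diff_res F i <= fr_cycles F i)%MS.
Proof.
case: i => [|i]; first exact: submx1.
by apply/sub_kermxP; exact: diff_res_comp.
Qed.

(** Chain maps between F and G in both directions, with composite homotopic to
the identity, embed the homology of F (x) k into that of G (x) k. *)
Lemma tor_dim_le F G i : (tor_dim F i <= tor_dim G i)%N.
Proof.
have [f fP] := chain_map_exists F G; have [g gP] := chain_map_exists G F.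
pose fk i := map_mx eps (f i); pose gk i := map_mx eps (g i).
have fkS j : fr_diff_res F j *m fk j = fk j.+1 *m fr_diff_res G j.
  by rewrite -!map_mxM (fP.2 j).
have gkS j : fr_diff_res G j *m gk j = gk j.+1 *m fr_diff_res F j.
  by rewrite -!map_mxM (gP.2 j).
have fgP := chain_map_comp fP gP.
have fgk j : fk j *m gk j - 1%:M = map_mx eps (f j *m g j - 1%:M).
  by rewrite map_mxB map_mx1 map_mxM.
apply: (subquotient_rank_le (f := fk i) (g := gk i)).
- exact: boundaries_sub_cycles.
- exact: boundaries_sub_cycles.
- case: i => [|i]; first exact: submx1.
  by apply/sub_kermxP; rewrite -mulmxA -fkS mulmxA mulmx_ker mul0mx.
- by rewrite gkS submxMl.
rewrite fgk; case: i => [|i].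
  by have [t ->] := chain_endo_homotopy0 fgP; rewrite map_mxM mulmxA submxMl.
have [s [t ->]] := chain_endo_homotopyS i fgP.
rewrite map_mxD !map_mxM mulmxDr mulmxA mulmx_ker mul0mx add0r mulmxA.
exact: submxMl.
Qed.

Lemma betti_tor_dim F i : betti eps i = tor_dim F i.
Proof.
apply: xget_unique; first by exists F.
by move=> _ [G <-]; apply/eqP; rewrite eqn_leq !tor_dim_le.
Qed.

End Comparison.

(** * Betti numbers and regular elements *)

Section TorRank.
Variables (A : comNzRingType) (k : fieldType) (eps : {rmorphism A -> k}).
Variable F : free_resolution eps.

(** The rank of the reduced differential that leaves degree i, so that all
degrees, including 0, obey the same formulas. *)
Definition diff_rank i := if i is j.+1 then \rank (fr_diff_res F j) else 0%N.

Lemma rank_cycles i : \rank (fr_cycles F i) = (fr_rank F i - diff_rank i)%N.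
Proof.
by case: i => [|i]; rewrite /fr_cycles ?mxrank1 ?subn0// mxrank_ker.
Qed.

Lemma tor_dim_rank i :
  tor_dim F i = (fr_rank F i - diff_rank i - \rank (fr_diff_res F i))%N.
Proof. by rewrite /tor_dim rank_cycles. Qed.

Lemma diff_rank_le i :
  (diff_rank i + \rank (fr_diff_res F i) <= fr_rank F i)%N.
Proof.
have := mxrankS (boundaries_sub_cycles F i); rewrite rank_cycles.
have : (diff_rank i <= fr_rank F i)%N by case: i => // i; exact: rank_leq_row.
lia.
Qed.

End TorRank.

(** Here B is A / (x), and [lam] is a point derivation at [eps] with value 1 at
the nonzerodivisor x.  It forces x to lie outside the square of the kernel of
[eps], and it recovers [eps h] from the product [x * h]. *)
Section RegularElement.
Variables (A B : comNzRingType) (k : fieldType).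
Variables (eps : {rmorphism A -> k}) (epsB : {rmorphism B -> k}).
Variables (pi : {rmorphism A -> B}) (x : A) (lam : {additive A -> k}).
Hypothesis eps_surj : forall c, exists a, eps a = c.
Hypothesis pi_surj : forall b, exists a, pi a = b.
Hypothesis pi_ker : forall a, pi a = 0 <-> exists b, a = x * b.
Hypothesis x_reg : forall a, x * a = 0 -> a = 0.
Hypothesis epsE : forall a, eps a = epsB (pi a).
Hypothesis lamM : forall a b, lam (a * b) = eps a * lam b + lam a * eps b.
Hypothesis lam_x : lam x = 1.

Lemma pi_x : pi x = 0.
Proof. by apply/pi_ker; exists 1; rewrite mulr1. Qed.

Lemma eps_x : eps x = 0.
Proof. by rewrite epsE pi_x rmorph0. Qed.

Lemma lam_mulx a : lam (x * a) = eps a.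
Proof. by rewrite lamM eps_x mul0r add0r lam_x mul1r. Qed.

(** Any lift a can be corrected by a multiple of x, which is invisible in B and
on which [lam] takes arbitrary values. *)
Lemma lift_mx p q (M : 'M[B]_(p, q)) :
  exists N : 'M[A]_(p, q), map_mx pi N = M /\ map_mx lam N = 0.
Proof.
have H (ij : 'I_p * 'I_q) : exists a, pi a = M ij.1 ij.2 /\ lam a = 0.
  have [a aP] := pi_surj (M ij.1 ij.2); have [c cP] := eps_surj (lam a).
  exists (a - x * c); rewrite rmorphB rmorphM pi_x mul0r subr0 aP; split=> //.
  by rewrite raddfB /= lam_mulx cP subrr.
have [N NP] := choice H.
exists (\matrix_(i, j) N (i, j)).
by split; apply/matrixP => i j; rewrite !mxE; have [] := NP (i, j).
Qed.

Lemma divx_mx p q (N : 'M[A]_(p, q)) :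
  map_mx pi N = 0 -> exists H, N = x *: H.
Proof.
move=> N0; have H (ij : 'I_p * 'I_q) : exists b, N ij.1 ij.2 = x * b.
  by apply/pi_ker; have /matrixP/(_ ij.1 ij.2) := N0; rewrite !mxE.
have [b bP] := choice H.
by exists (\matrix_(i, j) b (i, j)); apply/matrixP => i j; rewrite !mxE -bP.
Qed.

Lemma scalex_inj p q : injective (fun N : 'M[A]_(p, q) => x *: N).
Proof.
move=> M N /matrixP MN; apply/matrixP => i j.
have := MN i j; rewrite !mxE => /eqP; rewrite -subr_eq0 -mulrBr => /eqP/x_reg.
by move/eqP; rewrite subr_eq0 => /eqP.
Qed.

Lemma eps_mx p q (N : 'M[A]_(p, q)) : map_mx eps N = map_mx epsB (map_mx pi N).
Proof. by apply/matrixP => i j; rewrite !mxE epsE. Qed.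

(** [lam] sends the entries of x H to those of H reduced to k, and it vanishes on
products of elements at which it vanishes. *)
Lemma eps_quotient_eq0 p q r (M : 'M[A]_(p, q)) (N : 'M[A]_(q, r)) H :
    map_mx lam M = 0 -> map_mx lam N = 0 -> M *m N = x *: H ->
  map_mx eps H = 0.
Proof.
move=> /matrixP M0 /matrixP N0 /matrixP MN; apply/matrixP => i j.
rewrite !mxE -lam_mulx; have := MN i j; rewrite !mxE => <-.
rewrite raddf_sum big1// => l _ /=; rewrite lamM.
by have := M0 i l; have := N0 l j; rewrite !mxE => -> ->; rewrite mulr0 mul0r addr0.
Qed.

Section Lifting.
Variable G : free_resolution epsB.

(** The rank of G in degree i - 1, equal to 0 in degree -1: with the zero map
out of degree 0, the lifted complex has the same description in all degrees. *)
Definition prev_rank i := if i is j.+1 then fr_rank G j else 0%N.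

Definition inc_diff i : 'M[B]_(fr_rank G i, prev_rank i) :=
  if i is j.+1 then fr_diff G j else 0.

Variables (D : forall i, 'M[A]_(fr_rank G i, prev_rank i))
  (H : forall i, 'M[A]_(fr_rank G i.+1, prev_rank i)).
Hypothesis DP : forall i, map_mx pi (D i) = inc_diff i.
Hypothesis DD : forall i, D i.+1 *m D i = x *: H i.

Definition lift_rank i := (fr_rank G i + prev_rank i)%N.

(** The lifts D fail by x H to form a complex.  The second summand, mapped to the
first one by x, turns each A^(g_i) into a resolution of B^(g_i), and the entry
- H cancels the defect. *)
Definition lift_diff i : 'M[A]_(lift_rank i.+1, lift_rank i) :=
  block_mx (D i.+1) (- H i) x%:M (- D i).

Definition lift_aug : 'cV[k]_(lift_rank 0) := col_mx (fr_aug G) 0.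

Lemma mul_lift_diff p i (u : 'M[A]_(p, fr_rank G i.+1)) (v : 'M[A]_(p, fr_rank G i)) :
  row_mx u v *m lift_diff i =
  row_mx (u *m D i.+1 + x *: v) (- (u *m H i + v *m D i)).
Proof. by rewrite mul_row_block mul_mx_scalar !mulmxN opprD. Qed.

Lemma lift_defect_comm i : D i.+2 *m H i = H i.+1 *m D i.
Proof.
by apply: scalex_inj; rewrite /= scalemxAr -DD mulmxA DD scalemxAl.
Qed.

Lemma lift_diff_comp i : lift_diff i.+1 *m lift_diff i = 0.
Proof.
rewrite {1}/lift_diff/= /block_mx mul_col_mx !mul_lift_diff.
rewrite !mul_scalar_mx !scalerN !mulNmx !DD lift_defect_comm !subrr !oppr0.
by rewrite !row_mx0 col_mx0.
Qed.

Lemma lift_aug_surj (c : 'cV[k]_1) :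
  exists v : 'rV[A]_(lift_rank 0), map_mx eps v *m lift_aug = c.
Proof.
have [y yP] := fr_aug_surj G c; have [u [uP _]] := lift_mx y.
by exists (row_mx u 0); rewrite map_row_mx mul_row_col mulmx0 addr0 eps_mx uP.
Qed.

Lemma lift_exact0 (v : 'rV[A]_(lift_rank 0)) :
  map_mx eps v *m lift_aug = 0 <-> exists y, v = y *m lift_diff 0.
Proof.
rewrite -(hsubmxK (v : 'rV_(fr_rank G 0 + 0))); set u := lsubmx _.
rewrite (thinmx0 (rsubmx _)) map_row_mx mul_row_col mulmx0 addr0.
rewrite eps_mx; split=> [/fr_exact0[y yP]|[y]].
  have [w [wP _]] := lift_mx y.
  have : map_mx pi (u - w *m D 1%N) = 0.
    by rewrite map_mxB map_mxM DP wP /= yP subrr.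
  move=> /divx_mx[h hP]; exists (row_mx w h).
  by rewrite mul_lift_diff -hP addrC subrK; congr row_mx; rewrite !thinmx0.
rewrite -(hsubmxK (y : 'rV_(fr_rank G 1 + _))) mul_lift_diff => /eq_row_mx[-> _].
apply/fr_exact0; rewrite map_mxD map_mxM DP map_mxZ pi_x scale0r addr0.
by exists (map_mx pi (lsubmx y)).
Qed.

(** If (u, w) is a cycle, then u D is 0 modulo x, so that u = y D + x h by
exactness of G.  Subtracting the boundary of (y, h) leaves a cycle (0, w'), and
x w' = 0 gives w' = 0. *)
Lemma lift_exactS i (v : 'rV[A]_(lift_rank i.+1)) :
  v *m lift_diff i = 0 <-> exists y, v = y *m lift_diff i.+1.
Proof.
split=> [|[y ->]]; last by rewrite -mulmxA lift_diff_comp mulmx0.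
rewrite -(hsubmxK (v : 'rV_(fr_rank G i.+1 + fr_rank G i))).
set u := lsubmx _; set w := rsubmx _ => uw0.
have : map_mx pi u *m fr_diff G i = 0.
  move: uw0; rewrite mul_lift_diff => /(congr1 lsubmx).
  rewrite row_mxKl linear0 => /(congr1 (map_mx pi)).
  by rewrite map_mxD map_mxM DP map_mxZ pi_x scale0r addr0 map_mx0.
move=> /fr_exactS[y yP]; have [y' [y'P _]] := lift_mx y.
have : map_mx pi (u - y' *m D i.+2) = 0.
  by rewrite map_mxB map_mxM DP y'P yP subrr.
move=> /divx_mx[h hP]; exists (row_mx y' h).
have yhE : row_mx y' h *m lift_diff i.+1 = row_mx u (- (y' *m H i.+1 + h *m D i.+1)).
  by rewrite mul_lift_diff -hP addrC subrK.
rewrite yhE; congr row_mx.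
have := congr1 (mulmx (row_mx y' h)) (lift_diff_comp i).
rewrite mulmxA yhE mulmx0 -{}uw0 !mul_lift_diff => /(congr1 lsubmx).
by rewrite !row_mxKl => /addrI/scalex_inj.
Qed.

Definition lift_resolution : free_resolution eps :=
  FreeResolution lift_aug_surj lift_exact0 lift_exactS.

(** Reduced to k, both x and H vanish, and the lifted complex becomes the direct
sum of G (x) k and its shift. *)
Lemma tor_dim_lift_resolution i : (forall j, map_mx eps (H j) = 0) ->
  tor_dim lift_resolution i =
  (tor_dim G i + (if i is j.+1 then tor_dim G j else 0))%N.
Proof.
move=> H0.
have rankL j : \rank (fr_diff_res lift_resolution j) =
    (\rank (fr_diff_res G j) + diff_rank G j)%N.
  rewrite /fr_diff_res /= /lift_diff map_block_mx map_mxN H0 oppr0.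
  rewrite map_scalar_mx /= eps_x raddf0 rank_diag_block_mx map_mxN mxrank_opp.
  rewrite !eps_mx !DP /=; congr (_ + _)%N.
  by case: j => [|j] //=; rewrite map_mx0 mxrank0.
rewrite !tor_dim_rank rankL /=; case: i => [|i] /=.
  by rewrite /lift_rank /=; lia.
rewrite tor_dim_rank rankL /lift_rank /=.
have := diff_rank_le G i.+1; have := diff_rank_le G i => /=; lia.
Qed.

End Lifting.

(** The identity P^A(z) = (1 + z) P^B(z) between Poincare series, read off
coefficientwise. *)
Theorem betti_regular_quotient i : inhabited (free_resolution epsB) ->
  betti eps i = (betti epsB i + (if i is j.+1 then betti epsB j else 0))%N.
Proof.
case=> G.
have [D DP] : exists D : forall i, 'M[A]_(fr_rank G i, prev_rank G i),
    forall i, map_mx pi (D i) = inc_diff G i /\ map_mx lam (D i) = 0.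
  by exists (fun i => sval (cid (lift_mx (inc_diff G i)))) => j; case: cid.
have ex j : exists H, D j.+1 *m D j = x *: H.
  apply: divx_mx; rewrite map_mxM !(DP _).1.
  by case: j => [|j] /=; rewrite ?mulmx0 ?diff_comp.
pose H j := sval (cid (ex j)).
have DD j : D j.+1 *m D j = x *: H j by rewrite /H; case: cid.
have H0 j : map_mx eps (H j) = 0.
  by apply: eps_quotient_eq0 (DD j); have [] := DP j.+1; have [] := DP j.
rewrite (betti_tor_dim (lift_resolution (fun i => (DP i).1) DD)).
rewrite tor_dim_lift_resolution// (betti_tor_dim G).
by case: i => [//|i]; rewrite (betti_tor_dim G).
Qed.

End RegularElement.

(** * Existence of resolutions over finite-dimensional algebras *)

Definition submodule (A : comNzRingType) n (P : 'rV[A]_n -> Prop) :=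
  [/\ P 0, forall u v, P u -> P v -> P (u + v) & forall a u, P u -> P (a *: u)].

Definition row_generated (A : comNzRingType) n (P : 'rV[A]_n -> Prop) :=
  exists r (M : 'M[A]_(r, n)), forall u, P u <-> exists y, u = y *m M.

(** Stated for submodules of free modules of finite rank rather than for ideals,
which is the form in which syzygies use it. *)
Definition noetherian (A : comNzRingType) :=
  forall n (P : 'rV[A]_n -> Prop), submodule P -> row_generated P.

Section ResolutionExists.
Variables (A : comNzRingType) (k : fieldType) (eps : {rmorphism A -> k}).
Hypothesis noethA : noetherian A.

Lemma kernel_generated p q (d : 'M[A]_(p, q)) :
  row_generated (fun u : 'rV[A]_p => u *m d = 0).
Proof.
apply: noethA; split=> [|u v u0 v0|a u u0]; first by rewrite mul0mx.
- by rewrite mulmxDl u0 v0 addr0.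
- by rewrite -scalemxAl u0 scaler0.
Qed.

Definition syzygy_rank p q (d : 'M[A]_(p, q)) : nat :=
  sval (cid (kernel_generated d)).

Definition syzygy p q (d : 'M[A]_(p, q)) : 'M[A]_(syzygy_rank d, p) :=
  sval (cid (svalP (cid (kernel_generated d)))).

Lemma syzygyP p q (d : 'M[A]_(p, q)) (u : 'rV[A]_p) :
  u *m d = 0 <-> exists y, u = y *m syzygy d.
Proof. exact: (svalP (cid (svalP (cid (kernel_generated d))))). Qed.

(** A resolution is obtained by iterating [syzygy]; its dimensions vary along the
iteration, and are therefore packed with the matrix. *)
Record some_matrix := SomeMatrix { nrows; ncols; mat : 'M[A]_(nrows, ncols) }.

Lemma free_resolution_exists :
  (forall c, exists a, eps a = c) -> inhabited (free_resolution eps).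
Proof.
move=> eps_surj.
have [r [M MP]] : row_generated
    (fun u : 'rV[A]_1 => map_mx eps u *m (1%:M : 'cV[k]_1) = 0).
  apply: noethA; split=> [|u v|a u]; rewrite ?map_mx0 ?mul0mx//.
    by rewrite map_mxD mulmxDl => -> ->; rewrite addr0.
  by rewrite map_mxZ -scalemxAl => ->; rewrite scaler0.
pose st := fix st n :=
  if n is n'.+1 then SomeMatrix (syzygy (mat (st n'))) else SomeMatrix M.
pose d i : 'M[A]_(ncols (st i.+1), ncols (st i)) := mat (st i).
have aug_surj (c : 'cV[k]_1) :
    exists u : 'rV[A]_1, map_mx eps u *m (1%:M : 'cV[k]_1) = c.
  have [a aP] := eps_surj (c 0 0); exists a%:M.
  by rewrite map_scalar_mx mulmx1 aP -mx11_scalar.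
apply: inhabits; apply: (@FreeResolution A k eps (ncols \o st) d _ aug_surj) => //=.
by move=> i u; exact: syzygyP.
Qed.

End ResolutionExists.

(** A subspace given by a predicate that need not be decidable: take a subspace
contained in it, of maximal dimension. *)
Lemma span_of_closed (k : fieldType) (V : vectType k) (P : V -> Prop) :
    P 0 -> (forall a u v, P u -> P v -> P (a *: u + v)) ->
  exists U : {vspace V}, forall v, P v <-> v \in U.
Proof.
move=> P0 PD.
pose inP n := `[< exists2 U : {vspace V}, {in U, forall v, P v} & \dim U = n >].
have ex : exists n, inP n.
  exists 0%N; apply/asboolP; exists 0%VS; rewrite ?dimv0// => v.
  by rewrite memv0 => /eqP->.
have ub n : inP n -> (n <= \dim {:V})%N.
  by move=> /asboolP[U _ <-]; apply/dimvS/subvf.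
case: (ex_maxnP ex ub) => n /asboolP[U UP <-] Umax.
exists U => v; split=> [Pv|/UP//].
have /Umax dim_le : inP (\dim (U + <[v]>)).
  apply/asboolP; exists (U + <[v]>)%VS => // w.
  move=> /memv_addP[u uU [_ /vlineP[a ->] ->]].
  by rewrite addrC; apply: PD => //; exact: UP.
have /eqP -> : (U == U + <[v]>)%VS by rewrite eqEdim addvSl.
by rewrite memvE addvSr.
Qed.

Section FiniteAlgebra.
Variables (k : fieldType) (B : comNzRingType) (iota : {rmorphism k -> B}).
Variables (m : nat) (e : 'rV[B]_m).
Hypothesis e_span : forall b, exists c : 'cV[k]_m, b%:M = e *m map_mx iota c.

(** A submodule of B^n is a k-subspace of a finite-dimensional space, hence is
generated already over k by finitely many rows. *)
Lemma finite_algebra_noetherian : noetherian B.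
Proof.
move=> n P [P0 PD PZ].
(* The k-linear map from k^(m x n) onto B^n given by the generators e of B. *)
pose E (M : 'M[k]_(m, n)) : 'rV[B]_n := e *m map_mx iota M.
have E_surj u : exists M, u = E M.
  have [c cP] := choice (fun j => e_span (u 0 j)).
  exists (\matrix_(i, j) c j i 0); apply/rowP => j.
  have /matrixP/(_ 0 0) := cP j; rewrite !mxE eqxx mulr1n => ->.
  by apply: eq_bigr => i _; rewrite !mxE.
have EZD a M N : E (a *: M + N) = iota a *: E M + E N.
  by rewrite /E map_mxD map_mxZ mulmxDr -scalemxAr.
have E0 : E 0 = 0 by rewrite /E map_mx0 mulmx0.
have [||U UP] := @span_of_closed k _ (P \o E).
- by rewrite /= E0.
- by move=> a M N PM PN; rewrite /= EZD; apply: PD => //; apply: PZ.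
exists (\dim U), (\matrix_i E (vbasis U)`_i) => u; split=> [Pu|[y ->]].
  have [M uE] := E_surj u; move: Pu; rewrite uE => /UP MU.
  exists (\row_i iota (coord (vbasis U) i M)).
  rewrite {1}(coord_vbasis MU) mulmx_sum_row.
  have Esum (I : Type) (r : seq I) (c : I -> k) (N : I -> 'M[k]_(m, n)) :
      E (\sum_(i <- r) c i *: N i) = \sum_(i <- r) iota (c i) *: E (N i).
    by elim: r => [|i r IH]; rewrite ?big_nil// !big_cons EZD IH.
  by rewrite Esum; apply: eq_bigr => i _; rewrite rowK mxE.
rewrite mulmx_sum_row; elim/big_ind: _ => // i _; apply: PZ; rewrite rowK.
by apply/UP/vbasis_mem/mem_nth; rewrite size_tuple.
Qed.

End FiniteAlgebra.

(** * Apery sets and coefficients at Apery elements *)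

Section Apery.
Variable S : numerical_semigroup.
Local Notation m := (multiplicity S).
Local Notation a := (apery_elt S).

Lemma multiplicity_mem : S m.
Proof. by rewrite /multiplicity; case: ex_minnP => n /andP[]. Qed.

Lemma multiplicity_min n : (0 < n)%N -> S n -> (m <= n)%N.
Proof.
by rewrite /multiplicity; case: ex_minnP => p _ H n0 Sn; apply: H; rewrite n0.
Qed.

Lemma ns_memMl c n : S n -> S (c * m + n)%N.
Proof.
move=> Sn; elim: c => [//|c IH].
by rewrite mulSn -addnA; exact: ns_memD multiplicity_mem IH.
Qed.

Lemma apery_mem n : apery S n -> S n.
Proof. by case/andP. Qed.

Lemma apery_sub n : apery S n -> (m <= n)%N -> ~~ S (n - m)%N.
Proof. by case/andP => _ + mn; rewrite ltnNge mn. Qed.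

Lemma apery_eltP i : apery S (a i).
Proof. by have /andP[] := xchooseP (apery_ex S i). Qed.

Lemma apery_elt_mod i : a i = i %[mod m].
Proof. by have /andP[_ /eqP] := xchooseP (apery_ex S i). Qed.

(** A congruence class modulo m contains only one Apery element: if n1 < n2 are
congruent elements of S, then n2 - m is n1 plus a multiple of m, hence is in S. *)
Lemma apery_eq n n' : apery S n -> apery S n' -> n = n' %[mod m] -> n = n'.
Proof.
have lt n1 n2 : (n1 < n2)%N -> apery S n1 -> apery S n2 -> n1 = n2 %[mod m] -> False.
  move=> lt12 /apery_mem S1 ap2 e12.
  have q12 : (n1 %/ m < n2 %/ m)%N.
    have : (n1 %/ m * m + n1 %% m < n2 %/ m * m + n2 %% m)%N by rewrite -!divn_eq.
    by rewrite e12 ltn_add2r ltn_mul2r => /andP[].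
  have n2E : n2 = (m + ((n2 %/ m - (n1 %/ m).+1) * m + n1))%N.
    rewrite [LHS](divn_eq n2 m) -e12 {3}(divn_eq n1 m) !addnA.
    by rewrite -mulSn -mulnDl; congr (_ * _ + _)%N; lia.
  have mn2 : (m <= n2)%N by rewrite n2E leq_addr.
  by case/negP: (apery_sub ap2 mn2); rewrite n2E addKn; exact: ns_memMl.
move=> ap ap' e; case: (ltngtP n n') => // nn'; first by case: (lt _ _ nn').
by case: (lt _ _ nn').
Qed.

Lemma apery_index n : apery S n -> exists i : 'I_m, n = a i.
Proof.
move=> ap; exists (Ordinal (ltn_pmod n (multiplicity_gt0 S))).
apply: apery_eq => //; first exact: apery_eltP.
by rewrite apery_elt_mod /= modn_mod.
Qed.

Lemma apery_elt_inj (i j : 'I_m) : a i = a j -> i = j.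
Proof.
move=> /(congr1 (modn^~ m)); rewrite !apery_elt_mod !modn_small// => ij.
exact: val_inj.
Qed.

Lemma apery_elt0 : a 0 = 0%N.
Proof.
apply: apery_eq; rewrite ?apery_elt_mod//; first exact: apery_eltP.
by rewrite /apery ns_mem0 multiplicity_gt0.
Qed.

(** If u - m were in S, then so would be u + v - m.  This is why products can be
computed modulo t^m from the coefficients at Apery elements alone. *)
Lemma apery_summand u v : S u -> S v -> apery S (u + v)%N -> apery S u.
Proof.
move=> Su Sv ap; rewrite /apery Su /=; case: ltnP => //= mu.
apply: contra (apery_sub ap (leq_trans mu (leq_addr v u))) => Sum.
by rewrite addnC -addnBA// addnC; exact: ns_memD.
Qed.

End Apery.

Section SemigroupRing.
Variables (k : fieldType) (S : numerical_semigroup).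
Local Notation m := (multiplicity S).
Local Notation a := (apery_elt S).
Local Notation R := (semigroup_ring k S).
Implicit Types p q : R.

Lemma sring_coef p n : ~~ S n -> (val p)`_n = 0.
Proof. by case: p => p /= /semigroup_polyP H; apply: contraNeq => /H. Qed.

Fact const_in_sring (c : k) : c%:P \in @semigroup_poly k S.
Proof.
apply/semigroup_polyP => i; rewrite coefC; have [->|_] := eqVneq i 0%N; last by rewrite eqxx.
by rewrite ns_mem0.
Qed.

Definition sconst (c : k) : R := SemigroupRing (const_in_sring c).

Fact sconst_zmod_morphism : zmod_morphism sconst.
Proof. by move=> c d; apply: val_inj; rewrite /= polyCB. Qed.

Fact sconst_monoid_morphism : monoid_morphism sconst.
Proof. by split=> [|c d]; apply: val_inj; rewrite /= ?polyCM. Qed.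

HB.instance Definition _ := GRing.isZmodMorphism.Build k R sconst
  sconst_zmod_morphism.
HB.instance Definition _ := GRing.isMonoidMorphism.Build k R sconst
  sconst_monoid_morphism.

Fact monomial_in_sring n : S n -> 'X^n \in @semigroup_poly k S.
Proof.
move=> Sn; apply/semigroup_polyP => i; rewrite coefXn.
by have [->|_] := eqVneq i n; rewrite ?eqxx.
Qed.

Definition monomial n (Sn : S n) : R := SemigroupRing (monomial_in_sring Sn).

Definition tm : R := monomial (multiplicity_mem S).

(** This map is the point derivation required by [betti_regular_quotient] for the
element t^m. *)
Definition coef_tm p : k := (val p)`_m.

Fact coef_tm_zmod_morphism : zmod_morphism coef_tm.
Proof. by move=> p q; rewrite /coef_tm raddfB coefB. Qed.

HB.instance Definition _ := GRing.isZmodMorphism.Build R k coef_tm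
  coef_tm_zmod_morphism.

(** S has no element strictly between 0 and m, so only the two extreme terms of
the convolution survive. *)
Lemma coef_tmM p q :
  coef_tm (p * q) = @residue k S p * coef_tm q + coef_tm p * @residue k S q.
Proof.
rewrite /coef_tm /= coefM; have := multiplicity_gt0 S.
have small n : (0 < n < m)%N -> (val p)`_n = 0.
  case/andP=> n0 nm; apply: sring_coef; apply/negP => /(multiplicity_min n0).
  by rewrite leqNgt nm.
case: m small => // n small _.
rewrite big_ord_recl big_ord_recr /= subn0 /bump !add1n subnn.
by rewrite big1 ?add0r// => i _; rewrite small ?mul0r//= ltnS ltn_ord.
Qed.

Lemma coef_tm_tm : coef_tm tm = 1.
Proof. by rewrite /coef_tm /= coefXn eqxx. Qed.

Lemma tm_regular p : tm * p = 0 -> p = 0.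
Proof.
move=> /(congr1 val) /= /eqP; rewrite mulf_eq0 expf_eq0 polyX_eq0 andbF /=.
by move=> /eqP p0; apply: val_inj.
Qed.

Lemma residue_surj c : exists p, @residue k S p = c.
Proof. by exists (sconst c); rewrite /= coefC eqxx. Qed.

Lemma coef_apery_tmM p n : apery S n -> (val (tm * p))`_n = 0.
Proof.
move=> ap; rewrite /= coefXnM; case: ltnP => // mn.
exact: sring_coef (apery_sub ap mn).
Qed.

(** An element n of S outside the Apery set is m plus an element of S. *)
Lemma tm_divides p :
  (forall n, apery S n -> (val p)`_n = 0) -> exists q, p = tm * q.
Proof.
move=> p0.
have pS n : (val p)`_(n + m) != 0 -> S n.
  move=> pn; have Snm : S (n + m)%N.
    by move: pn; apply: contraR => /(sring_coef p)/eqP.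
  move: pn; apply: contraR => nSn; apply/eqP/p0.
  by rewrite /apery Snm addnK nSn orbT.
have qin : drop_poly m (val p) \in @semigroup_poly k S.
  by apply/semigroup_polyP => i; rewrite coef_drop_poly => /pS.
exists (SemigroupRing qin); apply: val_inj; apply/polyP => n.
rewrite /= coefXnM coef_drop_poly; case: ltnP => nm; last by rewrite subnK.
have [Sn|/(sring_coef p)//] := boolP (S n).
by apply: p0; rewrite /apery Sn nm.
Qed.

(** This is the multiplication table of k[S] / (t^m): by [apery_summand], only
the pairs of Apery elements with sum a_l contribute. *)
Lemma coef_aperyM p q (l : 'I_m) :
  (val (p * q))`_(a l) =
  \sum_i \sum_(j | (a (i : 'I_m) + a (j : 'I_m) == a l)%N) (val p)`_(a i) * (val q)`_(a j).
Proof.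
(* The term of index u of the convolution, spread over the pairs (i, j): at
   most one of them gives a nonzero value. *)
pose t u i j : k :=
  if (u == a i) && (a l - u == a j)%N then (val p)`_(a i) * (val q)`_(a j) else 0.
have tE (u : 'I_(a l).+1) : (val p)`_u * (val q)`_(a l - u) =
    \sum_(i < m) \sum_(j < m) t u i j.
  have ul : (u <= a l)%N by rewrite -ltnS ltn_ord.
  have [apu|apu] := boolP (apery S u && apery S (a l - u)%N).
    have /andP[/apery_index[i ui] /apery_index[j vj]] := apu.
    rewrite (bigD1 i)//= (bigD1 j)//= big1 ?big1 ?addr0.
    - by rewrite /t vj -ui !eqxx.
    - move=> i' ii'; rewrite big1// => j' _; rewrite /t.
      case: eqP => //= ui'; case/eqP: ii'; apply: apery_elt_inj; congruence.
    - move=> j' jj'; rewrite /t; case: eqP => //= _; case: eqP => // vj'.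
      case/eqP: jj'; apply: apery_elt_inj; congruence.
  rewrite big1 => [|i _]; last first.
    rewrite big1// => j _; rewrite /t; case: ifP => // /andP[/eqP ui /eqP vj].
    by case/negP: apu; rewrite ui -{2}ui vj !apery_eltP.
  have [Su|/(sring_coef p)->] := boolP (S u); last by rewrite mul0r.
  have [Sv|/(sring_coef q)->] := boolP (S (a l - u)%N); last by rewrite mulr0.
  have ap : apery S (u + (a l - u))%N by rewrite subnKC ?apery_eltP.
  case/negP: apu; rewrite (apery_summand Su Sv ap).
  by rewrite (apery_summand Sv Su)// addnC.
rewrite /= coefM (eq_bigr _ (fun u _ => tE u)) exchange_big; apply: eq_bigr => i _.
rewrite exchange_big [RHS]big_mkcond; apply: eq_bigr => j _ /=.
case: eqP => [ijl|ijl]; last first.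
  rewrite big1// => u _; rewrite /t; case: ifP => // /andP[/eqP ui /eqP vj].
  by case: ijl; rewrite -ui -vj subnKC// -ltnS ltn_ord.
have il : (a i < (a l).+1)%N by rewrite -ijl ltnS leq_addr.
rewrite (bigD1 (Ordinal il))//= big1 ?addr0.
  by rewrite /t eqxx -ijl addKn eqxx.
by move=> u uil; rewrite /t; case: eqP => //= ui; case/eqP: uil; apply: val_inj.
Qed.

End SemigroupRing.

(** * The algebra k[S] / (t^m) *)

(** The combinatorial data which determine k[S] / (t^m). *)
Definition same_apery_sums (S T : numerical_semigroup) :=
  multiplicity T = multiplicity S /\
  forall i j l : 'I_(multiplicity S),
    (apery_elt T i + apery_elt T j == apery_elt T l)%N =
    (apery_elt S i + apery_elt S j == apery_elt S l)%N.

Lemma same_apery_sums_refl S : same_apery_sums S S.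
Proof. by []. Qed.

Section AperyAlgebra.
Variables (k : fieldType) (S : numerical_semigroup).

(** A copy of the vector space with basis the Apery elements of S, to carry the
multiplication of k[S] / (t^m). *)
Definition apery_algebra := 'rV[k]_(multiplicity S).
HB.instance Definition _ := GRing.Zmodule.on apery_algebra.

Definition apery_mul (b c : apery_algebra) : apery_algebra :=
  \row_l \sum_i \sum_(j | (apery_elt S (i : 'I_(multiplicity S)) +
       apery_elt S (j : 'I_(multiplicity S)) == apery_elt S l)%N) b 0 i * c 0 j.

(** The projection of k[T] modulo t^m, in Apery coordinates.  T is not fixed to be
S, so that one algebra serves as the quotient of all the rings k[T] whose
Apery elements have the same sums as those of S. *)
Definition apery_class (T : numerical_semigroup) (p : semigroup_ring k T) :
  apery_algebra := \row_i (val p)`_(apery_elt T i).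

Fact apery_class_zmod_morphism T : zmod_morphism (@apery_class T).
Proof. by move=> p q; apply/rowP => i; rewrite !mxE raddfB coefB. Qed.

HB.instance Definition _ T := GRing.isZmodMorphism.Build
  (semigroup_ring k T) apery_algebra (@apery_class T)
  (@apery_class_zmod_morphism T).

(** The representative of the class b that is supported on the Apery set of T. *)
Definition apery_poly (T : numerical_semigroup) (b : apery_algebra) :
    semigroup_ring k T :=
  \sum_i sconst T (b 0 i) * monomial k (apery_mem (apery_eltP T i)).

Section SameSums.
Variable T : numerical_semigroup.
Hypothesis ST : same_apery_sums S T.

Lemma apery_elt_eq (i j : 'I_(multiplicity S)) :
  (apery_elt T i == apery_elt T j) = (i == j).
Proof.
apply/eqP/eqP => [|->//] ij; apply/val_inj.
move: ij => /(congr1 (modn^~ (multiplicity T))).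
by rewrite !apery_elt_mod ST.1 !modn_small.
Qed.

Lemma apery_polyK : cancel (apery_poly T) (@apery_class T).
Proof.
move=> b; apply/rowP => l; rewrite mxE /apery_poly raddf_sum coef_sum.
rewrite (bigD1 l)//= coefCM coefXn eqxx mulr1 big1 ?addr0// => i il.
by rewrite coefCM coefXn apery_elt_eq eq_sym (negbTE il) mulr0.
Qed.

Lemma apery_classM p q :
  apery_class (p * q) = apery_mul (@apery_class T p) (apery_class q).
Proof.
case: ST => mT eST.
apply/rowP => l; rewrite !mxE.
have := coef_aperyM p q (cast_ord (esym mT) l); rewrite /= => ->.
rewrite (reindex (cast_ord (esym mT))) /=; last first.
  by exists (cast_ord mT) => i _; apply: val_inj.
apply: eq_bigr => i _; rewrite (reindex (cast_ord (esym mT))) /=; last first.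
  by exists (cast_ord mT) => j _; apply: val_inj.
by apply: eq_big => [j|j _]; rewrite ?eST// !mxE.
Qed.

Lemma apery_class_eq0 p :
  @apery_class T p = 0 <-> exists q, p = tm k T * q.
Proof.
split=> [p0|[q ->]]; last first.
  apply/rowP => i; rewrite !mxE; exact: coef_apery_tmM (apery_eltP T i).
apply: tm_divides => n /apery_index[i ->].
by have /rowP/(_ (cast_ord ST.1 i)) := p0; rewrite !mxE.
Qed.

End SameSums.

(* [apery_class] maps k[S] onto the Apery algebra and commutes with products:
   the ring axioms are inherited from k[S]. *)
Let cls := @apery_class S.
Let clsK b : cls (apery_poly S b) = b := apery_polyK (same_apery_sums_refl S) b.
Let clsM p q : cls (p * q) = apery_mul (cls p) (cls q) :=
  apery_classM (same_apery_sums_refl S) p q.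

Fact apery_mulA : associative apery_mul.
Proof.
by move=> b c d; rewrite -(clsK b) -(clsK c) -(clsK d) -!clsM mulrA.
Qed.

Fact apery_mulC : commutative apery_mul.
Proof. by move=> b c; rewrite -(clsK b) -(clsK c) -!clsM mulrC. Qed.

Fact apery_mul1 : left_id (cls 1) apery_mul.
Proof. by move=> b; rewrite -(clsK b) -clsM mul1r. Qed.

Fact apery_mulDl : left_distributive apery_mul +%R.
Proof.
move=> b c d; rewrite -(clsK b) -(clsK c) -(clsK d) -!clsM.
by rewrite -[cls _ + cls _]raddfD -clsM mulrDl [LHS]raddfD.
Qed.

Fact apery_1_neq0 : cls 1 != 0.
Proof.
apply/eqP => /rowP/(_ (Ordinal (multiplicity_gt0 S))); rewrite !mxE /=.
by rewrite apery_elt0 coef1 eqxx => /eqP; rewrite oner_eq0.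
Qed.

HB.instance Definition _ := GRing.Zmodule_isComNzRing.Build apery_algebra
  apery_mulA apery_mulC apery_mul1 apery_mulDl apery_1_neq0.

Fact apery_class_monoid_morphism T :
  same_apery_sums S T -> monoid_morphism (@apery_class T).
Proof.
move=> ST; split; last exact: apery_classM.
have elt_eq0 U (i : 'I_(multiplicity S)) : same_apery_sums S U ->
    (apery_elt U i == 0%N) = (i == Ordinal (multiplicity_gt0 S)).
  by move=> SU; rewrite -(apery_elt_eq SU) /= apery_elt0.
by apply/rowP => i; rewrite !mxE !coef1 !elt_eq0.
Qed.

Definition apery_residue (b : apery_algebra) : k :=
  b 0 (Ordinal (multiplicity_gt0 S)).

Lemma apery_residueE T p : apery_residue (@apery_class T p) = @residue k T p.
Proof. by rewrite /apery_residue mxE /= apery_elt0. Qed.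

Fact apery_residue_zmod_morphism : zmod_morphism apery_residue.
Proof. by move=> b c; rewrite /apery_residue !mxE. Qed.

Fact apery_residue_monoid_morphism : monoid_morphism apery_residue.
Proof.
split=> [|b c]; first by rewrite apery_residueE rmorph1.
by rewrite -(clsK b) -(clsK c) -[_ * _]clsM !apery_residueE rmorphM.
Qed.

HB.instance Definition _ := GRing.isZmodMorphism.Build apery_algebra k
  apery_residue apery_residue_zmod_morphism.
HB.instance Definition _ := GRing.isMonoidMorphism.Build apery_algebra k
  apery_residue apery_residue_monoid_morphism.

Definition apery_class_rmorphism T (ST : same_apery_sums S T) :
    {rmorphism semigroup_ring k T -> apery_algebra} :=
  HB.pack_for {rmorphism semigroup_ring k T -> apery_algebra} (@apery_class T)
    (GRing.isMonoidMorphism.Build _ _ _ (apery_class_monoid_morphism ST)).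

Lemma apery_algebra_noetherian : noetherian apery_algebra.
Proof.
pose pi := apery_class_rmorphism (same_apery_sums_refl S).
pose iota : {rmorphism k -> apery_algebra} := pi \o sconst S.
apply: (@finite_algebra_noetherian k _ iota _
  (\row_i pi (monomial k (apery_mem (apery_eltP S i))))) => b.
exists (\col_i b 0 i); rewrite [LHS]mx11_scalar.
apply/matrixP => i j; rewrite !ord1 !mxE eqxx mulr1n -{1}(clsK b).
rewrite [LHS](raddf_sum pi); apply: eq_bigr => l _.
by rewrite !mxE mulrC -[RHS](rmorphM pi).
Qed.

(** The right-hand side only involves S, so it is the same for all the semigroups
T having the same Apery sums as S. *)
Theorem betti_semigroup_ring T i : same_apery_sums S T ->
  betti (@residue k T) i = (betti apery_residue i +
    (if i is j.+1 then betti apery_residue j else 0))%N.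
Proof.
move=> ST; pose pi := apery_class_rmorphism ST.
apply: (@betti_regular_quotient _ _ _ _ _ pi (tm k T) (@coef_tm k T)).
- exact: residue_surj.
- by move=> b; exists (apery_poly T b); exact: apery_polyK.
- exact: apery_class_eq0.
- exact: tm_regular.
- by move=> p; rewrite -apery_residueE.
- exact: coef_tmM.
- exact: coef_tm_tm.
apply: free_resolution_exists; first exact: apery_algebra_noetherian.
by move=> c; have [p <-] := residue_surj S c; exists (cls p); exact: apery_residueE.
Qed.

End AperyAlgebra.

(** * Faces of the Kunz cone *)

Section Faces.
Variables (R : realType) (n : nat).
Implicit Types (F : set 'rV[R]_n) (z : 'rV[R]_n).

(** From a relatively interior point z, the segment from z' to z can be prolonged
a little beyond z inside F. *)
Lemma relative_interior_extend F z z' : relative_interior F z -> F z' ->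
  exists2 t : R, t < 0 & F ((1 - t) *: z + t *: z').
Proof.
move=> [Fz nearF] Fz'.
pose y (t : R) := (1 - t) *: z + t *: z'.
have y0 : y 0 = z by rewrite /y subr0 scale1r scale0r addr0.
have yc : y t @[t --> (0 : R)] --> z.
  rewrite -y0; apply: cvgD; apply: cvgZr_tmp.
    by apply: cvgB; [exact: cvg_cst|exact: cvg_id].
  exact: cvg_id.
have /nbhs_ballP[e /= e0 eF] := yc _ nearF.
exists (- (e / 2)); first by rewrite oppr_lt0 divr_gt0.
apply: eF; last by move=> M [Maff FM]; apply: Maff; exact: FM.
rewrite /ball /= sub0r opprK ger0_norm; last by rewrite divr_ge0 ?ltW.
by rewrite ltr_pdivrMr// ltr_pMr// ltr1n.
Qed.

End Faces.

Section KunzFaces.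
Variables (R : realType) (m : nat) (F : set 'rV[R]_m.-1).
Hypothesis FC : F `<=` kunz_cone R m.

(** An inequality that is an equality at z and strict at z' would be violated
just beyond z on the line from z' to z. *)
Lemma face_tight (z z' : 'rV[R]_m.-1) (i j l : 'I_m.-1) :
    relative_interior F z -> F z' -> (i.+1 + j.+1 = l.+1 %[mod m])%N ->
  z 0 i + z 0 j = z 0 l -> z' 0 i + z' 0 j = z' 0 l.
Proof.
move=> Fz Fz' ijl zijl; have [t t0 /FC[_ yC]] := relative_interior_extend Fz Fz'.
have [_ z'C] := FC Fz'.
have := yC _ _ _ ijl; have := z'C _ _ _ ijl; rewrite !mxE -zijl => le1 le2.
by apply/eqP; rewrite eq_le le1 andbT; nra.
Qed.

(** The coordinates of a point of the Kunz cone are indexed by nonzero residues;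
the sums in which a residue is 0 are the same for all semigroups, as a_0 = 0 and
all the other Apery elements are positive. *)
Lemma face_apery_sum (S S' : numerical_semigroup)
    (i j l : nat) : (0 < m)%N ->
    multiplicity S = m -> multiplicity S' = m ->
    relative_interior F (kunz_point R m S) -> F (kunz_point R m S') ->
    (i < m)%N -> (j < m)%N -> (l < m)%N ->
  (apery_elt S i + apery_elt S j = apery_elt S l)%N ->
  (apery_elt S' i + apery_elt S' j = apery_elt S' l)%N.
Proof.
move=> m0 hS hS' FS FS' im jm lm ijl.
have cong : i + j = l %[mod m].
  have := congr1 (modn^~ m) ijl; rewrite -hS -modnDm !apery_elt_mod.
  by rewrite modnDm.
have inj i1 i2 : (i1 < m)%N -> (i2 < m)%N ->
    apery_elt S i1 = apery_elt S i2 -> i1 = i2.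
  move=> i1m i2m /(congr1 (modn^~ (multiplicity S))).
  by rewrite !apery_elt_mod hS !modn_small.
case: i => [|i] in im ijl cong *.
  by move: ijl; rewrite !apery_elt0 !add0n => /inj->.
case: j => [|j] in jm ijl cong *.
  by move: ijl; rewrite !apery_elt0 !addn0 => /inj->.
case: l => [|l] in lm ijl cong *.
  move: ijl => /eqP; rewrite apery_elt0 addn_eq0 -{1}(apery_elt0 S) => /andP[].
  by move=> /eqP/inj => /(_ im m0).
have p u : (u.+1 < m)%N -> (u < m.-1)%N by lia.
pose o u (um : (u.+1 < m)%N) : 'I_m.-1 := Ordinal (p u um).
have := @face_tight _ _ (o i im) (o j jm) (o l lm) FS FS' cong.
rewrite !mxE /= -!natrD ijl => /(_ erefl)/eqP.
by rewrite eqr_nat => /eqP.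
Qed.

Lemma face_same_apery_sums (S S' : numerical_semigroup) : (0 < m)%N ->
    multiplicity S = m -> multiplicity S' = m ->
    lies_in_face S F -> lies_in_face S' F ->
  same_apery_sums S S'.
Proof.
move=> m0 hS hS' FS FS'; split=> [|i j l]; first by rewrite hS.
have im (u : 'I_(multiplicity S)) : (u < m)%N by rewrite -hS.
apply/eqP/eqP; apply: face_apery_sum => //; first by have [] := FS.
by have [] := FS'.
Qed.

End KunzFaces.

Theorem proposition3p5 (R : realType) (k : fieldType) (m : nat)
    (S S' : numerical_semigroup) (F : set 'rV[R]_m.-1)
    (hm : (2 <= m)%N)
    (hS : multiplicity S = m) (hS' : multiplicity S' = m)
    (hF : is_face (kunz_cone R m) F)
    (hSF : lies_in_face S F) (hS'F : lies_in_face S' F) :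
  poincare_series k S = poincare_series k S' /\
  (rational_series (poincare_series k S) <->
   rational_series (poincare_series k S')).
Proof.
have FC : F `<=` kunz_cone R m by case: hF => l [_ ->] z [].
have SS' := face_same_apery_sums FC (ltnW hm) hS hS' hSF hS'F.
suff -> : poincare_series k S = poincare_series k S' by [].
apply/funext => i; rewrite /poincare_series.
by rewrite (betti_semigroup_ring k i SS') (betti_semigroup_ring k i (same_apery_sums_refl S)).
Qed.
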